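(* Let $a,b,c$ be integers. For every nonnegative integer $n$, $$\mathcal{QK}_{n}^{(a,b,c)}=2^{n}\Theta+\mathcal{QM}_{n}^{(a,b,c)},$$ where $\Theta=1+2^{a}\mathbf{i}+2^{b}\mathbf{j}+2^{c}\mathbf{k}$ and $$\mathcal{QM}_{n}^{(a,b,c)}=M_{n}+M_{n+a}\mathbf{i}+M_{n+b}\mathbf{j}+M_{n+c}\mathbf{k}=\omega_{1}^{n}\Phi_{1}+\omega_{2}^{n}\Phi_{2},$$ with $\Phi_{1}=1+\omega_{1}^{a}\mathbf{i}+\omega_{1}^{b}\mathbf{j}+\omega_{1}^{c}\mathbf{k}$ and $\Phi_{2}=1+\omega_{2}^{a}\mathbf{i}+\omega_{2}^{b}\mathbf{j}+\omega_{2}^{c}\mathbf{k}$.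
   Context: Let $\omega_1=\frac{-1+i\sqrt3}{2}$ and $\omega_2=\frac{-1-i\sqrt3}{2}$ (so $\omega_1=\omega_2^2$), where $i$ is the complex imaginary unit. For an integer $m$, let $M_m=2$ if $m\equiv 0 \pmod 3$ and $M_m=-1$ if $m\equiv 1,2\pmod 3$. The modified third-order Jacobsthal numbers are $K_m^{(3)}=2^m+\omega_1^m+\omega_2^m=2^m+M_m$; this formula is used for all integers $m$ (rational values for negative $m$). They satisfy $K_0^{(3)}=3$, $K_1^{(3)}=1$, $K_2^{(3)}=3$ and $K_{m+3}^{(3)}=K_m^{(3)}+7\cdot 2^m$. Quaternions have basis $1,\mathbf{i},\mathbf{j},\mathbf{k}$ with $\mathbf{i}^2=\mathbf{j}^2=\mathbf{k}^2=-1$, $\mathbf{i}\mathbf{j}=-\mathbf{j}\mathbf{i}=\mathbf{k}$, $\mathbf{j}\mathbf{k}=-\mathbf{k}\mathbf{j}=\mathbf{i}$, $\mathbf{k}\mathbf{i}=-\mathbf{i}\mathbf{k}=\mathbf{j}$. Expressions with complex coefficients are read in the complexified quaternion algebra $\mathbb{C}\otimes_{\mathbb{R}}\mathbb{H}$, where complex scalars (in particular $\omega_1,\omega_2$, whose imaginary unit $i$ is distinct from $\mathbf{i}$) commute with $\mathbf{i},\mathbf{j},\mathbf{k}$. The unrestricted modified third-order Jacobsthal quaternion is $\mathcal{QK}_{n}^{(a,b,c)}=K_{n}^{(3)}+K_{n+a}^{(3)}\mathbf{i}+K_{n+b}^{(3)}\mathbf{j}+K_{n+c}^{(3)}\mathbf{k}$,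 where $a,b,c$ are fixed integers. *)

(* Defs.v *)
From HB Require Import structures.
From mathcomp Require Import all_boot all_order all_algebra.
From mathcomp Require Import ring.
From mathcomp Require Import complex.
From mathcomp Require Import reals.

Set Implicit Arguments.
Unset Strict Implicit.
Unset Printing Implicit Defensive.

Import Order.TTheory GRing.Theory Num.Theory.
Local Open Scope ring_scope.

(* [quat F] is the Hamilton quaternion algebra with coefficients in the
   commutative ring F.  For F := R[i] it is the complexified algebra
   C (x)_R H: scalars of R[i] act through *: and hence commute with the units
   [qi], [qj], [qk]; the complex unit 'i%C is unrelated to [qi]. *)
Record quat (F : Type) := Quat { q0 : F; q1 : F; q2 : F; q3 : F }.

Section QuatChoice.
Variable F : Type.
Definition prod_of_quat (x : quat F) := (q0 x, q1 x, q2 x, q3 x).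
Definition quat_of_prod (p : F * F * F * F) :=
  let: (a, b, c, d) := p in Quat a b c d.
Lemma prod_of_quatK : cancel prod_of_quat quat_of_prod.
Proof. by case. Qed.
End QuatChoice.

HB.instance Definition _ (F : eqType) :=
  Equality.copy (quat F) (can_type (@prod_of_quatK F)).
HB.instance Definition _ (F : choiceType) :=
  Choice.copy (quat F) (can_type (@prod_of_quatK F)).

Section QuatAlgebra.
Variable F : comNzRingType.
Implicit Types x y z : quat F.

Definition addq x y :=
  Quat (q0 x + q0 y) (q1 x + q1 y) (q2 x + q2 y) (q3 x + q3 y).
Definition oppq x := Quat (- q0 x) (- q1 x) (- q2 x) (- q3 x).

Fact addqA : associative addq.
Proof. by case=> ? ? ? ? [? ? ? ?] [? ? ? ?]; rewrite /addq /= !addrA. Qed.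
Fact addqC : commutative addq.
Proof. by case=> ? ? ? ? [? ? ? ?]; congr Quat; rewrite addrC. Qed.
Fact add0q : left_id (Quat 0 0 0 0) addq.
Proof. by case=> ? ? ? ?; rewrite /addq /= !add0r. Qed.
Fact addNq : left_inverse (Quat 0 0 0 0) oppq addq.
Proof. by case=> ? ? ? ?; rewrite /addq /= !addNr. Qed.

HB.instance Definition _ :=
  GRing.isZmodule.Build (quat F) addqA addqC add0q addNq.

Definition mulq x y := Quat
  (q0 x * q0 y - q1 x * q1 y - q2 x * q2 y - q3 x * q3 y)
  (q0 x * q1 y + q1 x * q0 y + q2 x * q3 y - q3 x * q2 y)
  (q0 x * q2 y - q1 x * q3 y + q2 x * q0 y + q3 x * q1 y)
  (q0 x * q3 y + q1 x * q2 y - q2 x * q1 y + q3 x * q0 y).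

Fact mulqA : associative mulq.
Proof. by case=> ? ? ? ? [? ? ? ?] [? ? ? ?]; congr Quat => /=; ring. Qed.
Fact mul1q : left_id (Quat 1 0 0 0) mulq.
Proof. by case=> ? ? ? ?; congr Quat => /=; ring. Qed.
Fact mulq1 : right_id (Quat 1 0 0 0) mulq.
Proof. by case=> ? ? ? ?; congr Quat => /=; ring. Qed.
Fact mulqDl : left_distributive mulq +%R.
Proof. by case=> ? ? ? ? [? ? ? ?] [? ? ? ?]; congr Quat => /=; ring. Qed.
Fact mulqDr : right_distributive mulq +%R.
Proof. by case=> ? ? ? ? [? ? ? ?] [? ? ? ?]; congr Quat => /=; ring. Qed.
Fact oneq_neq0 : Quat 1 0 0 0 != 0 :> quat F.
Proof. by apply/eqP => -[] /eqP; rewrite oner_eq0. Qed.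

HB.instance Definition _ := GRing.Zmodule_isNzRing.Build (quat F)
  mulqA mul1q mulq1 mulqDl mulqDr oneq_neq0.

Definition scaleq (k : F) x := Quat (k * q0 x) (k * q1 x) (k * q2 x) (k * q3 x).

Fact scaleqA k l x : scaleq k (scaleq l x) = scaleq (k * l) x.
Proof. by rewrite /scaleq /= !mulrA. Qed.
Fact scale1q : left_id 1 scaleq.
Proof. by case=> ? ? ? ?; rewrite /scaleq /= !mul1r. Qed.
Fact scaleqDr : right_distributive scaleq +%R.
Proof. by move=> k [? ? ? ?] [? ? ? ?]; congr Quat; rewrite mulrDr. Qed.
Fact scaleqDl x : {morph scaleq^~ x : k l / k + l}.
Proof. by move=> k l; congr Quat; rewrite mulrDl. Qed.

HB.instance Definition _ := GRing.Zmodule_isLmodule.Build F (quat F)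
  scaleqA scale1q scaleqDr scaleqDl.

Fact scaleqAl (k : F) x y : k *: (x * y) = k *: x * y.
Proof. by case: x y => ? ? ? ? [? ? ? ?]; congr Quat => /=; ring. Qed.
HB.instance Definition _ := GRing.Lmodule_isLalgebra.Build F (quat F) scaleqAl.

Fact scaleqAr (k : F) x y : k *: (x * y) = x * (k *: y).
Proof. by case: x y => ? ? ? ? [? ? ? ?]; congr Quat => /=; ring. Qed.
HB.instance Definition _ := GRing.Lalgebra_isAlgebra.Build F (quat F) scaleqAr.

Definition qi : quat F := Quat 0 1 0 0.
Definition qj : quat F := Quat 0 0 1 0.
Definition qk : quat F := Quat 0 0 0 1.

Fact qi2 : qi * qi = -1. Proof. by congr Quat => /=; ring. Qed.
Fact qj2 : qj * qj = -1. Proof. by congr Quat => /=; ring. Qed.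
Fact qk2 : qk * qk = -1. Proof. by congr Quat => /=; ring. Qed.
Fact qij : qi * qj = qk. Proof. by congr Quat => /=; ring. Qed.
Fact qji : qj * qi = - qk. Proof. by congr Quat => /=; ring. Qed.
Fact qjk : qj * qk = qi. Proof. by congr Quat => /=; ring. Qed.
Fact qkj : qk * qj = - qi. Proof. by congr Quat => /=; ring. Qed.
Fact qki : qk * qi = qj. Proof. by congr Quat => /=; ring. Qed.
Fact qik : qi * qk = - qj. Proof. by congr Quat => /=; ring. Qed.

End QuatAlgebra.

Section Jacobsthal.
Variable R : realType.

Definition omega1 : R[i] := (-1 + 'i%C * (Num.sqrt 3)%:C%C) / 2.
Definition omega2 : R[i] := (-1 - 'i%C * (Num.sqrt 3)%:C%C) / 2.

(* The exponents below are integers, possibly negative. *)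
Definition jacK (m : int) : R[i] := 2 ^ m + omega1 ^ m + omega2 ^ m.

Definition jacM (m : int) : int := if (m == 0 %[mod 3])%Z then 2 else -1.

Variables a b c : int.

Definition QK (n : int) : quat R[i] :=
  (jacK n)%:A + jacK (n + a) *: qi _ + jacK (n + b) *: qj _
  + jacK (n + c) *: qk _.

Definition QM (n : int) : quat R[i] :=
  (jacM n)%:~R%:A + (jacM (n + a))%:~R *: qi _ + (jacM (n + b))%:~R *: qj _
  + (jacM (n + c))%:~R *: qk _.

Definition Theta : quat R[i] :=
  1 + (2 : R[i]) ^ a *: qi _ + (2 : R[i]) ^ b *: qj _ + (2 : R[i]) ^ c *: qk _.

Definition Phi1 : quat R[i] :=
  1 + omega1 ^ a *: qi _ + omega1 ^ b *: qj _ + omega1 ^ c *: qk _.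

Definition Phi2 : quat R[i] :=
  1 + omega2 ^ a *: qi _ + omega2 ^ b *: qj _ + omega2 ^ c *: qk _.

End Jacobsthal.
Arguments omega1 {R}.
Arguments omega2 {R}.

(* Main.v *)
(* The numbers omega1, omega2 have sum -1 and product 1, hence are inverse cube
   roots of unity; so omega1 ^ m + omega2 ^ m depends only on m mod 3 and equals
   jacM m.  Both identities then hold coordinatewise. *)
Require Import Defs.
From mathcomp Require Import all_boot all_order all_algebra.
From mathcomp Require Import complex reals.
From mathcomp Require Import ring.
Import GRing.Theory.
Local Open Scope ring_scope.

(** Passage to coordinates: equalities of quaternions become four equalities in [F]. *)
Lemma quat_basisE (F : comNzRingType) (x y z t : F) :
  x%:A + y *: qi F + z *: qj F + t *: qk F = Quat x y z t.
Proof. by congr Quat => /=; ring. Qed.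

Lemma quat_basis1E (F : comNzRingType) (y z t : F) :
  1 + y *: qi F + z *: qj F + t *: qk F = Quat 1 y z t.
Proof. by rewrite -quat_basisE scale1r. Qed.

Lemma scale_Quat (F : comNzRingType) (k x y z t : F) :
  k *: Quat x y z t = Quat (k * x) (k * y) (k * z) (k * t).
Proof. by []. Qed.

Lemma add_Quat (F : comNzRingType) (x y z t x' y' z' t' : F) :
  Quat x y z t + Quat x' y' z' t' = Quat (x + x') (y + y') (z + z') (t + t').
Proof. by []. Qed.

(** Euclidean division writes [m] as a multiple of [d] plus the remainder; since [w] is invertible,
    this covers negative [m] too. *)
Lemma exprz_modz (F : fieldType) (w : F) (d : nat) (m : int) :
  w != 0 -> w ^+ d = 1 -> w ^ m = w ^ (m %% d)%Z.
Proof.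
move=> w0 wd; rewrite {1}(divz_eq m d) expfzDr // (mulrC _ d%:Z) -exprz_exp.
by rewrite -(exprnP w d) wd exp1rz mul1r.
Qed.

Section CubeRoots.
Variable R : realType.
Local Notation w1 := (omega1 : R[i]).
Local Notation w2 := (omega2 : R[i]).

Lemma omega1D2 : w1 + w2 = -1.
Proof. by rewrite /omega1 /omega2; field. Qed.

Lemma omega1M2 : w1 * w2 = 1.
Proof.
have s3 : ((Num.sqrt 3 : R)%:C%C) ^+ 2 = 3.
  by rewrite -rmorphXn /= Num.Theory.sqr_sqrtr ?Num.Theory.ler0n ?rmorph_nat.
have i2 : ('i%C : R[i]) ^+ 2 = -1 by rewrite sqr_i.
(* The product is a difference of squares: (1 - i^2 * 3) / 4 = 1. *)
by rewrite /omega1 /omega2; field: s3 i2.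
Qed.

(** By the sum and the product, [w1] is a root of X^2 + X + 1, so its square is -1 - [w1]. *)
Lemma omega2E : w2 = w1 ^+ 2.
Proof.
have -> : w1 ^+ 2 = w1 * (w1 + w2) - w1 * w2 by ring.
by rewrite omega1D2 omega1M2 -[w2](addKr w1) omega1D2; ring.
Qed.

Lemma omega1X3 : w1 ^+ 3 = 1.
Proof. by rewrite exprS -omega2E omega1M2. Qed.

Lemma omega2X3 : w2 ^+ 3 = 1.
Proof. by rewrite omega2E exprAC omega1X3 expr1n. Qed.

Lemma omega12_neq0 : w1 != 0 /\ w2 != 0.
Proof. by apply/andP; rewrite -negb_or -mulf_eq0 omega1M2 oner_eq0. Qed.

Lemma jacME (m : int) : (jacM m)%:~R = w1 ^ m + w2 ^ m.
Proof.
have [w1_neq0 w2_neq0] := omega12_neq0.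
rewrite (exprz_modz _ w1 3) ?omega1X3 // (exprz_modz _ w2 3) ?omega2X3 //.
rewrite /jacM mod0z.
(* These bounds leave only the remainders 0, 1 and 2. *)
have := ltz_pmod m (isT : 0 < 3 :> int); have := modz_ge0 m (isT : 3 != 0 :> int).
case: (m %% 3)%Z => [[|[|[|//]]]|//] _ _ /=.
- by rewrite !expr0z.
- by rewrite !expr1z omega1D2.
(* Squaring swaps the two roots: [w2] squared is [w1] to the fourth, that is [w1]. *)
- rewrite -!exprnP -omega2E omega2E -exprM (exprD _ 3 1) omega1X3 mul1r -omega2E.
  by rewrite addrC omega1D2.
Qed.

End CubeRoots.

Theorem theorem2p3 (R : realType) (a b c : int) (n : nat) :
  QK R a b c n%:Z = (2 : R[i]) ^+ n *: Theta R a b c + QM R a b c n%:Z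
  /\ QM R a b c n%:Z
     = omega1 ^+ n *: Phi1 R a b c + omega2 ^+ n *: Phi2 R a b c.
Proof.
(* The shifts may be negative, so merging exponents requires a nonzero base. *)
have expD (x : R[i]) m : x != 0 -> x ^+ n * x ^ m = x ^ (n%:Z + m).
  by move=> x0; rewrite expfzDr.
have [w1_neq0 w2_neq0] := omega12_neq0 R.
have two_neq0 : (2 : R[i]) != 0 by rewrite Num.Theory.pnatr_eq0.
have QKE : QK R a b c n%:Z = Quat (jacK R n%:Z) (jacK R (n%:Z + a))
    (jacK R (n%:Z + b)) (jacK R (n%:Z + c)) := quat_basisE _ _ _ _ _.
have QME : QM R a b c n%:Z = Quat (jacM n%:Z)%:~R (jacM (n%:Z + a))%:~R
    (jacM (n%:Z + b))%:~R (jacM (n%:Z + c))%:~R := quat_basisE _ _ _ _ _.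
have -> : Theta R a b c = Quat 1 (2 ^ a) (2 ^ b) (2 ^ c).
  exact: quat_basis1E.
have -> : Phi1 R a b c = Quat 1 (omega1 ^ a) (omega1 ^ b) (omega1 ^ c).
  exact: quat_basis1E.
have -> : Phi2 R a b c = Quat 1 (omega2 ^ a) (omega2 ^ b) (omega2 ^ c).
  exact: quat_basis1E.
rewrite QKE QME; split.
(* In each coordinate both sides are 2^m + [omega1]^m + [omega2]^m, with m the shifted index. *)
- rewrite scale_Quat add_Quat mulr1 3?expD //.
  by rewrite 4!jacME /jacK 4!addrA exprnP.
- rewrite 2!scale_Quat add_Quat 2!mulr1 6?expD //.
  by rewrite 4!jacME 2!exprnP.
Qed.
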